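(* Let $n \ge 1$ and let $V_1,\dots,V_n$ be a family of non-zero vectors $V_r = (P_r,Q_r)$ in the plane whose coordinates $P_r, Q_r$ are non-negative integers. For a subset $K \subseteq \{1,\dots,n\}$ put $S_K = \sum_{r\in K} V_r$. Then the family $(V_r)_{1\le r\le n}$ provides a solution to ApSimon's Mints problem for $n$ mints if and only if for any two distinct non-empty subsets $K, J \subseteq \{1,\dots,n\}$ the vectors $S_K$ and $S_J$ are not collinear.
   Context: ApSimon's Mints problem: there are $n$ mints, numbered $1,\dots,n$. Each mint produces either only genuine coins or only fake coins. Every genuine coin has the same known weight $W>0$; every fake coin, regardless of the mint, has the same weight $W(1+\epsilon)$, where $\epsilon$ is an unknown non-zero real number (nothing else is known about $\epsilon$). Let $d_r = 1$ if mint $r$ produces fake coins and $d_r = 0$ otherwise, so that a coin from mint $r$ weighs $W(1+d_r\epsilon)$; any $(d_1,\dots,d_n)\in\{0,1\}^n$ is possible. Two precise weighings are performed, both fixed in advance: $P_r$ coins from mint $r$ (for each $r$) are put together on the scale in the first weighing, and $Q_r$ coins from mint $r$ in the second. Since $W$ is known, the outcomes of the weighings are equivalent to knowing the two numbers $a = \sum_{r} P_r d_r \epsilon$ and $b = \sum_r Q_r d_r\epsilon$. The family $V_r=(P_r,Q_r)$ ''provides a solution'' to the problem if the pair $(a,b)$ always determines which mints produce fake coins, i.e. if, whenever $d,d'\in\{0,1\}^n$ and non-zero real numbers $\epsilon,\epsilon'$ satisfy $\sum_r P_r d_r\epsilon = \sum_r P_r d'_r\epsilon'$ and $\sum_r Q_r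 d_r\epsilon = \sum_r Q_r d'_r\epsilon'$, one has $d=d'$. (No minimality of the number of coins is required.) Two vectors in the plane are collinear if they are linearly dependent over $\mathbb{R}$. *)

(* Defs.v *)
From HB Require Import structures.
From mathcomp Require Import all_boot all_order all_algebra.
From mathcomp Require Import reals.
Set Implicit Arguments.
Unset Strict Implicit.
Unset Printing Implicit Defensive.
Import Order.TTheory GRing.Theory Num.Theory.
Local Open Scope ring_scope.

Definition plane_vec (R : realType) (p q : nat) : 'rV[R]_2 :=
  \row_(i < 2) (if i == 0 then p%:R else q%:R).

(* [free] takes a sequence, not a set: [free [:: u; u]] is false, so a vector
   is collinear with itself. *)
Definition collinear (R : realType) (u v : 'rV[R]_2) : bool :=
  ~~ free [:: u; v].

(* Excess over the all-genuine weight, in units of W, when C r coins are taken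
   from mint r: a coin from mint r weighs W * (1 + d r * eps). *)
Definition excess (R : realType) (n : nat) (C : 'I_n -> nat)
    (d : {ffun 'I_n -> bool}) (eps : R) : R :=
  \sum_(r < n) (C r)%:R * (d r)%:R * eps.

Definition provides_solution (R : realType) (n : nat) (P Q : 'I_n -> nat) :
    Prop :=
  forall (d d' : {ffun 'I_n -> bool}) (eps eps' : R),
    eps != 0 -> eps' != 0 ->
    excess P d eps = excess P d' eps' ->
    excess Q d eps = excess Q d' eps' ->
    d = d'.

Definition subset_sum (R : realType) (n : nat) (P Q : 'I_n -> nat)
    (K : {set 'I_n}) : 'rV[R]_2 :=
  \sum_(r in K) plane_vec R (P r) (Q r).

(* Main.v *)
(* The data of a weighing pair with fake set K and parameter eps amount to the
   vector eps *: S_K. Since coordinates are non-negative, S_K != 0 for K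
   non-empty, so ambiguity eps *: S_K = eps' *: S_J between non-empty sets is
   exactly collinearity of S_K and S_J, and K empty is never confused with a
   non-empty J. *)
Require Import Defs.
From HB Require Import structures.
From mathcomp Require Import all_boot all_order all_algebra.
From mathcomp Require Import reals.
Set Implicit Arguments.
Unset Strict Implicit.
Unset Printing Implicit Defensive.
Import Order.TTheory GRing.Theory Num.Theory.
Local Open Scope ring_scope.

Lemma plane_vec_inj (R : realType) (p q p' q' : nat) :
  plane_vec R p q = plane_vec R p' q' -> p = p' /\ q = q'.
Proof.
move=> /rowP E.
by split; [have := E 0 | have := E 1];
  rewrite !mxE /= => /eqP; rewrite eqr_nat => /eqP.
Qed.

Lemma plane_vec_eq0 (R : realType) (p q : nat) :
  (plane_vec R p q == 0) = (p == 0%N) && (q == 0%N).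
Proof.
have -> : 0 = plane_vec R 0 0 by apply/rowP => i; rewrite !mxE if_same.
apply/eqP/andP => [/plane_vec_inj[-> ->]//|[/eqP-> /eqP->//]].
Qed.

(** Keeping the coordinates as sums in [nat], cast to [R] only at the end, makes their
    non-negativity available for free. *)
Lemma subset_sumE (R : realType) (n : nat) (P Q : 'I_n -> nat)
    (K : {set 'I_n}) :
  subset_sum R P Q K = plane_vec R (\sum_(r in K) P r) (\sum_(r in K) Q r).
Proof.
apply/rowP => i; rewrite summxE mxE !natr_sum.
by case: ifP => i0; apply: eq_bigr => r _; rewrite mxE i0.
Qed.

(** No cancellation is possible: a zero sum of natural numbers has only zero terms, so any [r] in
    [K] would have both coordinates zero, against [hV]. *)
Lemma subset_sum_eq0 (R : realType) (n : nat) (P Q : 'I_n -> nat)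
    (hV : forall r, plane_vec R (P r) (Q r) != 0) (K : {set 'I_n}) :
  (subset_sum R P Q K == 0) = (K == set0).
Proof.
apply/idP/eqP => [|->]; last by rewrite /subset_sum big_set0.
rewrite subset_sumE plane_vec_eq0 !sum_nat_eq0 => /andP[/forall_inP P0].
move=> /forall_inP Q0; apply/setP => r; rewrite inE; apply/negP => rK.
by move: (hV r); rewrite plane_vec_eq0 P0 ?Q0.
Qed.

Lemma excessE (R : realType) (n : nat) (C : 'I_n -> nat)
    (d : {ffun 'I_n -> bool}) (eps : R) :
  excess C d eps = eps * (\sum_(r in [set r | d r]) C r)%:R.
Proof.
rewrite natr_sum mulr_sumr big_mkcond; apply: eq_bigr => r _.
by rewrite inE; case: (d r); rewrite ?mulr1 ?mulr0 ?mul0r // mulrC.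
Qed.

Lemma excess_eqP (R : realType) (n : nat) (P Q : 'I_n -> nat)
    (d d' : {ffun 'I_n -> bool}) (eps eps' : R) :
  (excess P d eps = excess P d' eps' /\ excess Q d eps = excess Q d' eps') <->
  eps *: subset_sum R P Q [set r | d r] =
    eps' *: subset_sum R P Q [set r | d' r].
Proof.
rewrite !excessE !subset_sumE; split=> [[EP EQ]|/rowP E].
  by apply/rowP => i; rewrite !mxE; case: ifP.
by split; [have := E 0 | have := E 1]; rewrite !mxE.
Qed.

(** The factor is recorded as non-zero, which [u != 0] forces, so that it can serve as a value of
    the unknown parameter. *)
Lemma collinearP (R : realType) (u v : 'rV[R]_2) : u != 0 -> v != 0 ->
  reflect (exists2 k, k != 0 & u = k *: v) (collinear u v).
Proof.
move=> u0 v0; rewrite /collinear free_cons seq1_free v0 andbT negbK span_seq1.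
apply: (iffP (vlineP _ _)) => [[k E]|[k _ E]]; exists k => //.
by apply: contraNneq u0 => k0; rewrite E k0 scale0r.
Qed.

Theorem theorem1 (R : realType) (n : nat) (hn : (1 <= n)%N)
    (P Q : 'I_n -> nat) (hV : forall r : 'I_n, plane_vec R (P r) (Q r) != 0) :
  provides_solution R P Q <->
  (forall K J : {set 'I_n}, K != J -> K != set0 -> J != set0 ->
     ~~ collinear (subset_sum R P Q K) (subset_sum R P Q J)).
Proof.
split=> [sol K J KJ K0 J0|ncol d d' eps eps' e0 e'0 EP EQ].
  apply/negP => /collinearP; rewrite !subset_sum_eq0 // => /(_ K0 J0)[k k0 E].
  pose ind (A : {set 'I_n}) := [ffun r => r \in A].
  have indK A : [set r | ind A r] = A by apply/setP => r; rewrite inE ffunE.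
  (* Read S_K = k S_J as two indistinguishable situations: fake set [K] with parameter 1, and fake
     set [J] with parameter [k]. *)
  have [EP EQ] : excess P (ind K) 1 = excess P (ind J) k /\
      excess Q (ind K) 1 = excess Q (ind J) k.
    by apply/excess_eqP; rewrite !indK scale1r.
  move/eqP: KJ; apply; rewrite -[K]indK -[J]indK.
  by rewrite (sol _ _ _ _ (oner_neq0 R) k0 EP EQ).
have E := (excess_eqP P Q d d' eps eps').1 (conj EP EQ).
have [KJ|KJ] := eqVneq [set r | d r] [set r | d' r].
  by apply/ffunP => r; move/setP/(_ r): KJ; rewrite !inE.
(* Both parameters are non-zero, so in [E] one subset sum vanishes exactly when the other does. *)
have K0J0 : ([set r | d r] == set0) = ([set r | d' r] == set0).
  rewrite -!(subset_sum_eq0 hV).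
  by have /(congr1 (eq_op^~ 0)) := E; rewrite !scaler_eq0 (negbTE e0) (negbTE e'0).
have [K0|K0] := boolP ([set r | d r] == set0).
  by move: KJ; rewrite (eqP K0) eq_sym -K0J0 K0.
have J0 : [set r | d' r] != set0 by rewrite -K0J0.
have /negP[] := ncol _ _ KJ K0 J0.
apply/collinearP; rewrite ?subset_sum_eq0 //.
(* This factor comes from solving [E] for the sum over the fake set of [d]. *)
exists (eps^-1 * eps'); first by rewrite mulf_neq0 ?invr_eq0.
by rewrite -scalerA -E scalerA mulVf // scale1r.
Qed.
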